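(* Let $(G,\gamma)$ be an edge-colored simple graph with $n>2$ vertices, $m$ edges, and $\ell$ colors. (1) The smallest possible number of colors is $\ell=1$. In this case, $\operatorname{wld}(G)=0$. (2) If $\ell=2$, then $\operatorname{wld}(G)=\kappa(G_1)+\kappa(G_2)-2$. (3) If $\ell=m-1>1$, then \[\operatorname{wld}(G)=\begin{cases}1 & \text{if } n=3,\\ n-1 & \text{if } n>3.\end{cases}\] (4) The largest possible number of colors is $\ell=m$. In this case, $\operatorname{wld}(G)=n-1$.
   Context: An edge-colored graph $(G,\gamma)$ is a finite connected graph $G$ with a surjective function $\gamma:E(G)\to\mathcal{C}=\{c_1,\dots,c_\ell\}$ onto a finite set of colors (not necessarily a proper edge-coloring). For each color $c_i$ let $E_i(G)=\{e\in E(G):\gamma(e)=c_i\}$ and let $G_i$ be the graph with vertex set $V(G)$ and edge set $E_i(G)$; $\kappa(G_i)$ is its number of connected components. For $W\subseteq E(G)$, let $G_i^W$ be the graph with vertex set $V(G)$ and edge set $W\cup E_i(G)$. The set $W$ is color-connecting if $G_i^W$ is connected for every color $c_i\in\mathcal{C}$. The wild number $\operatorname{wld}(G)$ is the minimum size of a color-connecting set. *)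

(* Defs.v *)
From mathcomp Require Import all_boot.

Set Implicit Arguments.
Unset Strict Implicit.
Unset Printing Implicit Defensive.

(* Finite undirected graphs; loops (one end) and parallel edges (same ends) *)
(* are excluded only by [simple]. *)
Record graph : Type := Graph {
  vertex : finType;
  edge : finType;
  ends : edge -> {set vertex};
  card_ends : forall e, 0 < #|ends e| <= 2
}.

Definition simple (G : graph) : Prop :=
  (forall e : edge G, #|ends e| = 2) /\ injective (@ends G).

Section SpanningSubgraph.
Variables (G : graph) (F : {set edge G}).

(* Adjacency in the graph with vertex set V(G) and edge set F. *)
Definition adj : rel (vertex G) :=
  fun x y => [exists e in F, ends e == [set x; y]].

Definition connected : bool := [forall x, forall y, connect adj x y].

Definition kappa : nat := n_comp adj predT.

End SpanningSubgraph.

(* The colors are exactly the elements of [color]; the coloring is not *)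
(* required to be proper. *)
Record edge_coloring (G : graph) : Type := EdgeColoring {
  color : finType;
  gamma : edge G -> color;
  gamma_surj : forall c, exists e, gamma e = c
}.

Section Wild.
Variables (G : graph) (g : edge_coloring G).

Definition ncolors : nat := #|color g|.

Definition color_class (c : color g) : {set edge G} :=
  [set e | gamma g e == c].

Definition color_connecting (W : {set edge G}) : bool :=
  [forall c, connected (W :|: color_class c)].

(* The default [setT] makes this a true minimum when G is connected, see *)
(* [color_connectingT] and [wldP]; for disconnected G no set is *)
(* color-connecting as soon as there is a color, and the value is junk. *)
Definition wld : nat :=
  #|[arg min_(W < [set: edge G] | color_connecting W) #|W| ]|.

Lemma color_connectingT : connected [set: edge G] -> color_connecting setT.
Proof. by move=> connG; apply/forallP=> c; rewrite setTU. Qed.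

Lemma wldP : connected [set: edge G] ->
  (exists2 W, color_connecting W & #|W| = wld) /\
  (forall W, color_connecting W -> wld <= #|W|).
Proof.
move=> /color_connectingT ccT; rewrite /wld.
by case: arg_minnP => // W ccW minW; split; first exists W.
Qed.

End Wild.

(* Main.v *)
Require Import Defs.
From mathcomp Require Import all_boot.

(* Adding an edge to an edge set F lowers the number of components kappa F by
   at most one, and by exactly one when it joins two components; so the least
   number of edges needed to connect F is kappa F - 1.  For two colors the
   edges that connect G_1 and those that connect G_2 can be taken in the
   disjoint sets E_2 and E_1.  In general let s = m - l be the sum of |E_i| - 1
   over the colors.  If s < n - 2 then a color-connecting set W has at least
   n - 1 edges: otherwise W, being disconnected, contains no E_i, so that W and
   E_1 together have at most s + 1 < n - 1 edges and are not connected.  This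
   covers s = 0, and s = 1 for n > 3; for n = 3 any two edges connect G. *)

(** * Connectivity and component counts of spanning subgraphs *)

Section Connectivity.
Set Implicit Arguments.
Unset Strict Implicit.

Variable G : graph.
Implicit Types (F W : {set edge G}) (e : edge G) (x y : vertex G).

Lemma adj_sym F : symmetric (adj F).
Proof. by move=> x y; apply: eq_existsb => e; rewrite setUC. Qed.

Lemma adj_connect_sym F : connect_sym (adj F).
Proof. exact/sym_connect_sym/adj_sym. Qed.

Lemma sub_connect_adj F F' x y :
  F \subset F' -> connect (adj F) x y -> connect (adj F') x y.
Proof.
move=> sFF'; apply: connect_sub => {}x {}y /exists_inP[e eF xy].
by apply/connect1/exists_inP; exists e; first exact: (subsetP sFF').
Qed.

Lemma connectedP F :
  reflect (forall x y, connect (adj F) x y) (connected F).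
Proof. by apply: (iffP forallP) => H x; apply/forallP. Qed.

Lemma sub_connected F F' : F \subset F' -> connected F -> connected F'.
Proof.
by move=> sFF' /connectedP H; apply/connectedP=> x y; exact: sub_connect_adj (H x y).
Qed.

Lemma connect_ends F e x y :
  e \in F -> x \in ends e -> y \in ends e -> connect (adj F) x y.
Proof.
move=> eF xe ye; have [->|xy] := eqVneq x y; first exact: connect0.
apply/connect1/exists_inP; exists e => //.
rewrite eq_sym eqEcard subUset !sub1set xe ye cards2 xy.
by have /andP[] := card_ends e.
Qed.

(** A loop is the case [a = b]. *)
Lemma endsP e : exists a b, ends e = [set a; b].
Proof.
have /andP[] := card_ends e; case E: #|ends e| => [|[|[|n]]] // _ _.
  by move/eqP/cards1P: E => [a ->]; exists a, a; rewrite setUid.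
by move/eqP/cards2P: E => [a [b [_ ->]]]; exists a, b.
Qed.

Lemma kappaE F : kappa F = #|[set x | roots (adj F) x]|.
Proof. by rewrite cardsE; apply: eq_card => x; rewrite !inE andbT. Qed.

Lemma kappa0 : kappa (set0 : {set edge G}) = #|vertex G|.
Proof.
rewrite kappaE -cardsT; congr #|pred_of_set _|; apply/setP=> x; rewrite !inE.
apply/eqP; move: (connect_root (adj set0) x); move: (root _ _) => y.
case/connectP=> -[|z p] //= /andP[/exists_inP[e]].
by rewrite inE.
Qed.

Lemma connected_kappa F : connected F = (kappa F <= 1).
Proof.
rewrite kappaE; apply/connectedP/card_le1_eqP => [H x y|H x y].
  rewrite !inE => /eqP<- /eqP<-.
  by apply/eqP; rewrite root_connect ?H //; apply: adj_connect_sym.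
have sF := @adj_connect_sym F.
by rewrite -root_connect //; apply/eqP/H; rewrite inE roots_root.
Qed.

(** A path that uses [e] may be cut at its first and last passage through [e]: the outer stretches
    lie in [F] and start or stop at [a] or [b]. *)
Lemma connect_setU1 F e a b x y : ends e = [set a; b] ->
  connect (adj (e |: F)) x y ->
  [\/ connect (adj F) x y,
      connect (adj F) x a /\ connect (adj F) b y
    | connect (adj F) x b /\ connect (adj F) a y].
Proof.
move=> eab /connectP[p]; elim: p x => [|z p IHp] x /=.
  by move=> _ ->; apply: Or31; apply: connect0.
case/andP=> /exists_inP[e' e'F e'xz] pz yl.
have := IHp z pz yl; move: e'F; rewrite !inE => /orP[/eqP ee'|e'F].
  (* The path starts with [e] itself, so [x] is [a] or [b]; of what follows, only the stretch after
     the last passage through [e] is kept. *)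
  have: x \in [set a; b] /\ z \in [set a; b].
    by rewrite -eab -ee' (eqP e'xz) !inE !eqxx orbT.
  rewrite !inE => -[/pred2P[]-> /pred2P[]->] [H|[_ H]|[_ H]];
    by [apply: Or31 | apply: Or32; split; rewrite ?connect0
       | apply: Or33; split; rewrite ?connect0].
have xz: connect (adj F) x z.
  by apply/connect1/exists_inP; exists e'.
by case=> [H|[H ?]|[H ?]]; [apply: Or31|apply: Or32|apply: Or33];
  try split=> //; apply: connect_trans H.
Qed.

(** Only the components of [a] and [b] can merge. With the root of [a] set aside, sending a root to
    its new root is therefore injective. *)
Lemma kappa_setU1_ge F e : kappa F <= (kappa (e |: F)).+1.
Proof.
have [a [b eab]] := endsP e.
have sF := @adj_connect_sym F; have seF := @adj_connect_sym (e |: F).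
rewrite !kappaE (cardsD1 (root (adj F) a)) -add1n leq_add ?leq_b1 //.
rewrite -(@card_in_imset _ _ (root (adj (e |: F)))).
  by apply/subset_leq_card/subsetP=> _ /imsetP[x _ ->]; rewrite inE roots_root.
move=> x y; rewrite !inE => /andP[xa /eqP rx] /andP[ya /eqP ry] /eqP.
rewrite root_connect // => /(connect_setU1 eab)[xy|[xa' _]|[_ ya']].
- by rewrite -rx -ry; apply/eqP; rewrite root_connect.
- by rewrite -rx root_connect // xa' in xa.
- by rewrite -ry root_connect // sF ya' in ya.
Qed.

(** The roots for [e |: F] inject into the roots for [F], and the image cannot contain both the root
    of [a] and that of [b]. *)
Lemma kappa_setU1_lt F e a b : a \in ends e -> b \in ends e ->
  ~~ connect (adj F) a b -> kappa (e |: F) < kappa F.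
Proof.
move=> ae be nab.
have sF := @adj_connect_sym F; have seF := @adj_connect_sym (e |: F).
rewrite !kappaE -(@card_in_imset _ _ (root (adj F))); last first.
  move=> x y; rewrite !inE => /eqP rx /eqP ry /eqP; rewrite root_connect // => xy.
  rewrite -rx -ry; apply/eqP; rewrite root_connect //.
  by apply: sub_connect_adj xy; exact: subsetUr.
apply/proper_card/properP; split.
  by apply/subsetP=> _ /imsetP[x _ ->]; rewrite inE roots_root.
set I := imset _ _.
suff: (root (adj F) a \notin I) || (root (adj F) b \notin I).
  by case/orP=> H; [exists (root (adj F) a)|exists (root (adj F) b)];
    rewrite ?inE ?roots_root.
rewrite -negb_and; apply: contra nab => /andP[].
case/imsetP=> x; rewrite inE => /eqP rx /eqP; rewrite root_connect // => ax.
case/imsetP=> y; rewrite inE => /eqP ry /eqP; rewrite root_connect // => yb.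
(* Since [e] joins [a] to [b], the roots [x] and [y] for [e |: F] lie in one component of it and
   coincide; this would link [a] to [b] within [F]. *)
suff xy : x = y by rewrite (connect_trans ax) // sF xy.
rewrite -rx -ry; apply/eqP; rewrite root_connect //.
have ab : connect (adj (e |: F)) a b.
  by apply: connect_ends ae be; rewrite setU11.
have sub := sub_connect_adj (subsetUr [set e] F).
by apply: connect_trans (connect_trans ab (sub _ _ yb)); rewrite seF sub.
Qed.

(** Used when [W :|: F] is connected: then [W] has at least [kappa F - 1] edges. *)
Lemma kappa_setU_ge F W : kappa F <= #|W| + kappa (W :|: F).
Proof.
move En: #|W| => n; elim: n W En => [|n IHn] W En.
  by move/eqP: En; rewrite cards_eq0 => /eqP->; rewrite set0U.
have [e eW] : exists e, e \in W by apply/card_gt0P; rewrite En.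
have Wn : #|W :\ e| = n by move: En; rewrite (cardsD1 e) eW => -[].
apply: leq_trans (IHn _ Wn) _.
by rewrite addSnnS leq_add2l -{2}(setD1K eW) -setUA kappa_setU1_ge.
Qed.

(** Greedy construction: while [F] is disconnected, some edge of the connected graph joins two of
    its components, and adding it lowers [kappa]. *)
Lemma connected_setU_exists F : connected [set: edge G] -> 0 < #|vertex G| ->
  exists2 W, connected (W :|: F) & #|W| < kappa F.
Proof.
move=> /connectedP connG /card_gt0P[x0 _].
elim: {F}(kappa F).+1 {-2}F (ltnSn (kappa F)) => // k IHk F; rewrite ltnS => Fk.
have [connF|disF] := boolP (connected F).
  exists set0; rewrite ?set0U // cards0 kappaE; apply/card_gt0P.
  by exists (root (adj F) x0); rewrite inE (roots_root (@adj_connect_sym F)).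
have [e [a [b [ae be nab]]]] :
    exists e a b, [/\ a \in ends e, b \in ends e & ~~ connect (adj F) a b].
  have [/existsP[e /existsP[a /existsP[b /and3P[]]]]|/existsPn H] := boolP
    [exists e, exists a, exists b,
      [&& a \in ends e, b \in ends e & ~~ connect (adj F) a b]].
    by exists e, a, b.
  (* If no edge crossed between components, each step of a path in [G] could be replaced by a path
     in [F]. *)
  case/connectedP: disF => x y; apply: connect_sub (connG x y) => {}x {}y.
  case/exists_inP=> e _ /eqP exy; move/existsPn/(_ x)/existsPn/(_ y): (H e).
  by rewrite exy !inE !eqxx orbT /= negbK.
have lt := kappa_setU1_lt ae be nab.
have [W connW ltW] := IHk _ (leq_trans lt Fk).
exists (e |: W); first by rewrite -setUA setUCA.
by rewrite cardsU1 (leq_ltn_trans _ lt) // (leq_trans _ ltW) // -add1n leq_add2r leq_b1.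
Qed.

End Connectivity.

(** * Bounds on the wild number *)

Section WildNumber.
Set Implicit Arguments.
Unset Strict Implicit.

Variables (G : graph) (g : edge_coloring G).
Hypothesis G_connected : connected [set: edge G].
Implicit Types (W : {set edge G}) (c : color g).

Lemma wld_le W : (forall c, connected (W :|: color_class c)) -> wld g <= #|W|.
Proof. by move=> ccW; apply: (proj2 (wldP g G_connected)); apply/forallP. Qed.

Lemma le_wld k :
  (forall W, (forall c, connected (W :|: color_class c)) -> k <= #|W|) ->
  k <= wld g.
Proof.
by move=> H; have [[W /forallP ccW <-] _] := wldP g G_connected; apply: H.
Qed.

Lemma color_class_gt0 (c : color g) : 0 < #|color_class c|.
Proof. by have [e ec] := gamma_surj c; apply/card_gt0P; exists e; rewrite inE ec. Qed.

Lemma ncolors_le : ncolors g <= #|edge G|.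
Proof.
rewrite -(size_codom (@gamma _ g)) /ncolors cardE uniq_leq_size ?enum_uniq // => c _.
by have [e <-] := gamma_surj c; exact: codom_f.
Qed.

Lemma card_by_color (A : {set edge G}) :
  #|A| = \sum_(c : color g) #|A :&: color_class c|.
Proof.
rewrite -sum1_card (partition_big (@gamma _ g) predT) //=; apply: eq_bigr => c _.
by rewrite -sum1_card; apply: eq_bigl => e; rewrite !inE.
Qed.

(** Surjectivity makes every class nonempty, so the predecessors do not truncate; the sum is the
    excess [m - l]. *)
Lemma card_edges :
  #|edge G| = ncolors g + \sum_(c : color g) #|color_class c|.-1.
Proof.
rewrite -cardsT card_by_color /ncolors -sum1_card -big_split; apply: eq_bigr => c _.
by rewrite setTI /= add1n prednK ?color_class_gt0.
Qed.

(** A set that connects all vertices on its own, such as a spanning tree, serves every color at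
    once. *)
Lemma wld_le_pred : 0 < #|vertex G| -> wld g <= #|vertex G| - 1.
Proof.
move=> n_gt0; have [W connW ltW] := connected_setU_exists set0 G_connected n_gt0.
rewrite kappa0 setU0 in connW ltW; rewrite subn1 -ltnS prednK //.
apply: leq_ltn_trans (wld_le _) ltW => c.
exact: sub_connected (subsetUl _ _) connW.
Qed.

Lemma connected_card W : connected W -> #|vertex G| <= #|W|.+1.
Proof.
rewrite connected_kappa => W1; have := kappa_setU_ge set0 W.
by rewrite kappa0 setU0 -addn1 => /leq_trans; apply; rewrite leq_add2l.
Qed.

Lemma color_class_not_sub W (c : color g) : #|W|.+1 < #|vertex G| ->
  connected (W :|: color_class c) -> ~~ (color_class c \subset W).
Proof.
move=> ltW; apply: contraL => /setUidPl->.
by apply: contraL ltW => /connected_card; rewrite -leqNgt.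
Qed.

Lemma wld_two (c1 c2 : color g) : ncolors g = 2 -> c1 != c2 -> 0 < #|vertex G| ->
  wld g = kappa (color_class c1) + kappa (color_class c2) - 2.
Proof.
move=> two c12 n_gt0; set F1 := color_class c1; set F2 := color_class c2.
have cP c : c = c1 \/ c = c2.
  apply/pred2P; have /setP/(_ c) : [set c1; c2] = [set: color g].
    by apply/eqP; rewrite eqEcard subsetT cardsT cards2 c12 -two leqnn.
  by rewrite !inE.
apply/eqP; rewrite eqn_leq; apply/andP; split.
  have [W1 conn1 lt1] := connected_setU_exists F1 G_connected n_gt0.
  have [W2 conn2 lt2] := connected_setU_exists F2 G_connected n_gt0.
  (* One set repairs both colors: [W1] takes care of [c1] and [W2] of [c2]. *)
  apply: (@leq_trans #|W1 :|: W2|).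
    apply: wld_le => c; case: (cP c) => ->.
      by apply: sub_connected conn1; rewrite setSU ?subsetUl.
    by apply: sub_connected conn2; rewrite setSU ?subsetUr.
  (* Subtracting 2 does not truncate, as both values of [kappa] are positive. *)
  rewrite leq_subRL; last first.
    by rewrite (@leq_add 1 1) // ?(leq_trans _ lt1) ?(leq_trans _ lt2).
  have := leq_add lt1 lt2; rewrite addSn addnS -add2n; apply: leq_trans.
  by rewrite leq_add2l cardsU leq_subr.
apply: le_wld => W ccW; rewrite leq_subLR.
(* Edges of color [c] do not help to connect the class of [c], so only the rest of [W] counts. *)
have bound c : kappa (color_class c) <= #|W :\: color_class c|.+1.
  have := kappa_setU_ge (color_class c) (W :\: color_class c).
  have -> : W :\: color_class c :|: color_class c = W :|: color_class c.
    by apply/setP=> e; rewrite !inE; case: (_ == _); rewrite ?orbT.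
  rewrite -addn1 => /leq_trans; apply.
  by rewrite leq_add2l -connected_kappa.
apply: leq_trans (leq_add (bound c1) (bound c2)) _.
rewrite addSn addnS -add2n leq_add2l -cardsUI.
(* The edges of [W] counted for [c1] and for [c2] are disjoint, since each edge has one of the two
   colors. *)
suff -> : (W :\: F1) :&: (W :\: F2) = set0.
  by rewrite cards0 addn0 subset_leq_card // subUset !subsetDl.
apply/setP=> e; rewrite !inE; case: (cP (gamma g e)) => ->;
  by rewrite eqxx ?andbF.
Qed.

(** The hypothesis is [m - l < n - 2], written without subtraction. *)
Lemma wld_few_repeats : 0 < ncolors g ->
  #|edge G| + 2 < ncolors g + #|vertex G| -> wld g = #|vertex G| - 1.
Proof.
case/card_gt0P=> c _; rewrite card_edges -addnA ltn_add2l.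
set s := \sum_(_ : _) _ => lt_s.
have n_gt0 : 0 < #|vertex G| by apply: leq_ltn_trans lt_s.
apply/eqP; rewrite eqn_leq wld_le_pred //=; apply: le_wld => W ccW.
rewrite leqNgt subn1 -ltnS prednK //; apply/negP=> ltW.
have := connected_card (ccW c); rewrite leqNgt => /negP; apply.
apply: leq_ltn_trans lt_s; rewrite -[2]addn1 addnA addn1 ltnS.
(* The union of [W] and the class of [c] is counted by color: [c] contributes at most its whole
   class, which explains the extra 1, and every other color misses an edge of its class. *)
rewrite card_by_color /s (bigD1 c) //= [X in _ <= X + 1](bigD1 c) //= addnAC.
apply: leq_add.
  by rewrite addn1 prednK ?color_class_gt0 // subset_leq_card // subsetIr.
apply: leq_sum => c' c'c.
rewrite -ltnS prednK ?color_class_gt0 //; apply/proper_card/properP.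
split; first exact: subsetIr.
have /subsetPn[e ec' eW] := color_class_not_sub ltW (ccW c').
exists e => //; rewrite !inE (negPf eW) /=; move: ec'; rewrite inE => /eqP->.
by rewrite (negPf c'c).
Qed.

(** In a simple graph two edges have distinct pairs of ends, and two distinct pairs among three
    vertices cover them all and share one. *)
Lemma connected_two_edges W : simple G -> #|vertex G| = 3 -> 1 < #|W| -> connected W.
Proof.
move=> [ends2 ends_inj] n3 /card_gt1P[e [e' [eW e'W ee']]].
have cup : ends e :|: ends e' = setT.
  apply/eqP; rewrite eqEcard subsetT cardsT n3 -(ends2 e) ltnNge /=.
  apply: contra ee' => le2; apply/eqP/ends_inj/eqP.
  have /eqP E : ends e == ends e :|: ends e' by rewrite eqEcard subsetUl.
  by rewrite eq_sym eqEcard !ends2 leqnn andbT E subsetUr.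
have [v ve ve'] : exists2 v, v \in ends e & v \in ends e'.
  (* Inclusion-exclusion reads [3 + 1 = 2 + 2]. *)
  have /card_gt0P[v] : 0 < #|ends e :&: ends e'|.
    have := cardsUI (ends e) (ends e'); rewrite cup cardsT n3 !ends2.
    by move/(@addnI 3 _ 1)->.
  by case/setIP; exists v.
have vx x : connect (adj W) v x.
  have : x \in ends e :|: ends e' by rewrite cup inE.
  by case/setUP; [apply: connect_ends eW ve|apply: connect_ends e'W ve'].
apply/connectedP=> x y; apply: connect_trans (vx y).
by rewrite (@adj_connect_sym _ W).
Qed.

(** By [l < m] two edges share a color, and one of them forms a color-connecting set; by [m < 2l]
    some class has a single edge, so the empty set fails. *)
Lemma wld_three_vertices : simple G -> #|vertex G| = 3 ->
  ncolors g < #|edge G| < (ncolors g).*2 -> wld g = 1.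
Proof.
move=> G_simple n3 /andP[lt_c lt_2c]; apply/eqP; rewrite eqn_leq; apply/andP; split.
  have /injectivePn[e [e' ee' gee']] : ~~ injectiveb (@gamma _ g).
    by apply: contraL lt_c => /injectiveP/leq_card; rewrite -leqNgt.
  rewrite -(cards1 e); apply: wld_le => c; apply: connected_two_edges => //.
  (* A second edge besides [e] is [e'] for the color of [e], and any edge of color [c] otherwise. *)
  have [ce|ce] := eqVneq (gamma g e) c.
    by apply/card_gt1P; exists e, e'; rewrite !inE -?gee' ce !eqxx ?orbT.
  have /card_gt0P[f] := color_class_gt0 c; rewrite inE => /eqP fc.
  apply/card_gt1P; exists e, f; rewrite !inE fc !eqxx orbT; split=> //.
  by apply: contraNneq ce => ->; rewrite fc.
apply: le_wld => W ccW; rewrite card_gt0; apply: contraTneq lt_2c => W0.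
rewrite -leqNgt -cardsT card_by_color -muln2 /ncolors -sum_nat_const.
apply: leq_sum => c _; rewrite setTI -ltnS -n3.
by have := connected_card (ccW c); rewrite W0 set0U.
Qed.

End WildNumber.

Theorem theorem6p4 (G : graph) (g : edge_coloring G)
    (G_connected : connected [set: edge G]) (G_simple : simple G)
    (n_gt2 : 2 < #|vertex G|) :
  [/\ (* (1) *)
      [/\ 1 <= ncolors g,
          exists g' : edge_coloring G, ncolors g' = 1
        & ncolors g = 1 -> wld g = 0],
      (* (2) *)
      ncolors g = 2 ->
        forall c1 c2 : color g, c1 != c2 ->
          wld g = kappa (color_class c1) + kappa (color_class c2) - 2,
      (* (3) *)
      ncolors g = #|edge G| - 1 -> 1 < ncolors g ->
        wld g = if #|vertex G| == 3 then 1 else #|vertex G| - 1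
    & (* (4) *)
      [/\ ncolors g <= #|edge G|,
          exists g' : edge_coloring G, ncolors g' = #|edge G|
        & ncolors g = #|edge G| -> wld g = #|vertex G| - 1]].
Proof.
have n_gt0 : 0 < #|vertex G| by apply: leq_trans n_gt2.
have [e0] : exists e0 : edge G, true.
  (* More than two vertices force an edge, since [n <= m + 1]. *)
  have : 0 < #|[set: edge G]|.
    by have := leq_trans n_gt2 (connected_card G_connected); case: #|_|.
  by case/card_gt0P=> e0; exists e0.
move=> _; have c_gt0 : 0 < ncolors g by apply/card_gt0P; exists (gamma g e0).
split=> [|two c1 c2 c12|c_eq c_gt1|].
- split=> //.
    have const_surj (c : unit) : exists e : edge G, tt = c by exists e0; case: c.
    by exists (EdgeColoring const_surj); rewrite /ncolors card_unit.
  move=> one; apply/eqP; rewrite -leqn0 -(cards0 (edge G)); apply: wld_le => // c.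
  apply: sub_connected G_connected; rewrite set0U; apply/subsetP=> e _; rewrite inE.
  by apply/eqP/(card_le1_eqP (A := color g)) => //; rewrite -/(ncolors g) one.
- exact: wld_two.
(* The edge [e0] ensures that [m - 1] is not truncated. *)
- have m_eq : #|edge G| = (ncolors g).+1.
    by rewrite c_eq subn1 prednK //; apply/card_gt0P; exists e0.
  case: eqVneq => [n3|n3].
    apply: wld_three_vertices => //.
    (* Here [l + 1 < 2l] is where [l > 1] enters. *)
    by rewrite m_eq leqnn -addnn -[X in X < _]add1n ltn_add2r.
  apply: wld_few_repeats => //.
  by rewrite m_eq addSn -addnS ltn_add2l ltn_neqAle eq_sym n3.
- split; first exact: ncolors_le.
    have id_surj (c : edge G) : exists e, e = c by exists c.
    by exists (EdgeColoring id_surj).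
  by move=> c_eq; apply: wld_few_repeats => //; rewrite c_eq ltn_add2l.
Qed.
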